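(* Let $N\ge 2$ and $\alpha=(\alpha_0,\dots,\alpha_{N-1})\in\triangle_N$. The infinite product $$f(z):=\prod_{r=1}^{\infty}\sum_{n=0}^{N-1}\alpha_n\exp\left(-\frac{nz}{N^r}\right)$$ is well-defined (converges) for every $z\in\mathbb{C}$. Furthermore, $f$ is entire and $\mathcal{L}_{\mu^\alpha}(s)=f(s)$ for all $s\in\mathbb{R}$.
   Context: $\triangle_N$ is the set of $\alpha=(\alpha_0,\dots,\alpha_{N-1})\in\mathbb{R}^N$ with all $\alpha_n\ge 0$ and $\sum_n\alpha_n=1$. For $\alpha\in\triangle_N$ (with $N\ge2$), the $\alpha$-weighted Cantor measure $\mu^\alpha$ is the unique Borel probability measure on $\mathbb{R}$ supported in $[0,1]$ satisfying $\mu^\alpha(E)=\sum_{n=0}^{N-1}\alpha_n\mu^\alpha(\varphi_n^{-1}(E))$ for all Borel sets $E$, where $\varphi_n(x)=(x+n)/N$. The Laplace transform of a finite measure $\mu$ on $[0,1]$ is $\mathcal{L}_\mu(s)=\int_0^1 e^{-sx}\,d\mu(x)$, $s\in\mathbb{R}$. *)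

(* Defs.v *)
From HB Require Import structures.
From mathcomp Require Import all_boot all_order all_algebra.
From mathcomp Require Import all_classical all_reals all_analysis.
From mathcomp Require Import complex.

Set Implicit Arguments.
Unset Strict Implicit.
Unset Printing Implicit Defensive.

Import Order.TTheory GRing.Theory Num.Theory.
Import numFieldNormedType.Exports.

Local Open Scope classical_set_scope.
Local Open Scope ring_scope.
Local Open Scope complex_scope.

(* [R[i]] carries its topology, and its structure of normed module over
   itself, only through the alias [_^o]. *)
Notation Cplx R := ((complex R)^o).

Definition simplex (R : realType) (N : nat) : set ('I_N -> R) :=
  [set alpha | (forall n, 0 <= alpha n) /\ \sum_(n < N) alpha n = 1].

Definition cantor_map (R : realType) (N n : nat) (x : R) : R := (x + n%:R) / N%:R.

(* Support in [0, 1] is expressed by nullity of the complement, which is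
   equivalent because [0, 1] is closed. *)
Definition weighted_cantor_measure (R : realType) (N : nat)
    (alpha : 'I_N -> R) (mu : probability (measurableTypeR R) R) : Prop :=
  mu (~` `[0, 1]%classic) = 0%E /\
  forall E : set (measurableTypeR R), measurable E ->
    mu E = (\sum_(n < N) (alpha n)%:E * mu (cantor_map N n @^-1` E))%E.

Definition laplace (R : realType)
    (mu : {finite_measure set (measurableTypeR R) -> \bar R}) (s : R) : R :=
  \int[mu]_(x in `[0, 1]%classic) expR (- (s * x)).

Definition cexp (R : realType) (z : Cplx R) : Cplx R :=
  (expR (complex.Re z) * cos (complex.Im z)) +i*
    (expR (complex.Re z) * sin (complex.Im z)).

(* Convergence of an infinite product in the classical sense: from some rank
   on the factors are nonzero and their partial products have a nonzero
   limit.  Finitely many factors may vanish, and the full sequence of partial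
   products then converges as well, so that [infprod u] is its limit. *)
Definition infprod_cvg (R : realType) (u : nat -> Cplx R) : Prop :=
  exists m : nat, (forall k, (m <= k)%N -> u k != 0) /\
    exists2 q : Cplx R, q != 0 &
      (\prod_(m <= k < n) u k : Cplx R) @[n --> \oo] --> q.

Definition infprod (R : realType) (u : nat -> Cplx R) : Cplx R :=
  limn (fun n => \prod_(0 <= k < n) u k : Cplx R).

Definition cantor_factor (R : realType) (N : nat) (alpha : 'I_N -> R)
    (z : Cplx R) (r : nat) : Cplx R :=
  \sum_(n < N) (alpha n)%:C * cexp (- (n%:R * z / (N%:R ^+ r))).

(* The product runs over r >= 1, hence the shift. *)
Definition cantor_factors (R : realType) (N : nat) (alpha : 'I_N -> R)
    (z : Cplx R) : nat -> Cplx R :=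
  fun k => cantor_factor alpha z k.+1.

Definition cantor_product (R : realType) (N : nat) (alpha : 'I_N -> R)
    (z : Cplx R) : Cplx R :=
  infprod (cantor_factors alpha z).

(* The increment in [derivable] ranges over the scalar field, here the complex
   numbers, so this is complex differentiability at every point. *)
Definition entire (R : realType) (f : Cplx R -> Cplx R) : Prop :=
  forall z : Cplx R, derivable f z 1.

(* Main.v *)
(* The n-th partial product is a convex combination of exponentials e^(-xz)
   with x in [0, 1].  This gives bounds that are locally uniform in z and
   uniform in n, for the partial products and for their second-order Taylor
   remainders; the latter pass to the limit, which is therefore complex
   differentiable, without any appeal to Cauchy's integral formula.  The
   product converges because its k-th factor is 1 + O(|z| / N^k).  Finally,
   self-similarity of the measure gives L(s) = P(s/N) L(s/N), where P(s/N^k)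
   is the k-th factor; iterating, L(s) is the n-th partial product times
   L(s/N^n), which tends to 1. *)

Require Import Defs.
From HB Require Import structures.
From mathcomp Require Import all_boot all_order all_algebra.
From mathcomp Require Import all_classical all_reals all_analysis.
From mathcomp Require Import complex.
From mathcomp Require Import measurable_realfun.
From mathcomp Require Import ring lra.

Set Implicit Arguments.
Unset Strict Implicit.
Unset Printing Implicit Defensive.

Import Order.TTheory GRing.Theory Num.Theory.
Import numFieldNormedType.Exports.
Import Normc.

Local Open Scope classical_set_scope.
Local Open Scope ring_scope.
Local Open Scope complex_scope.

(** * Quadratic estimates for the real sine, cosine and exponential *)

Section RealEstimates.
Variable R : realType.
Implicit Types x : R.

Lemma ler_norm_sin x : `|sin x| <= `|x|.
Proof.
wlog x0 : x / 0 <= x.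
  move=> H; have [/H//|x0] := leP 0 x.
  by rewrite -[X in sin X]opprK sinN normrN -(normrN x) H// oppr_ge0 ltW.
have [|c _] := MVT_segment (f := sin) (df := cos) x0.
- exact/continuous_subspaceT/continuous_sin.
rewrite sin0 !subr0 => ->; rewrite normrM.
by rewrite ler_piMl// cos_max.
Qed.

(** Half-angle formula: [cos x] is [1 - 2 sin^2 (x / 2)]. *)
Lemma cos_lower_bound x : 1 - x ^+ 2 / 2 <= cos x.
Proof.
have {2}-> : x = (x / 2) *+ 2 by rewrite -mulr_natr mulfVK ?pnatr_eq0.
rewrite cos_mulr2n cos2sin2.
have : sin (x / 2) ^+ 2 <= (x / 2) ^+ 2.
  rewrite -[leLHS]real_normK ?num_real// -[leRHS]real_normK ?num_real//.
  by rewrite lerXn2r ?nnegrE// ler_norm_sin.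
have -> : x ^+ 2 / 2 = (x / 2) ^+ 2 * 2 by field.
by rewrite mulr2n => h; lra.
Qed.

(** By the mean value theorem [sin x - x] is [(cos c - 1) x] with [c] between 0 and [x]; the cubic
    bound this gives is weakened using [|x| <= 1]. *)
Lemma norm_sinB_le x : `|x| <= 1 -> `|sin x - x| <= x ^+ 2 / 2.
Proof.
wlog x0 : x / 0 <= x.
  move=> H; have [/H//|x0] := leP 0 x.
  have -> : sin x - x = - (sin (- x) - - x) by rewrite sinN; ring.
  rewrite normrN -(normrN x) -sqrrN => x1.
  by apply: H => //; rewrite oppr_ge0 ltW.
have [|c] := MVT_segment (f := sin) (df := cos) x0.
- exact/continuous_subspaceT/continuous_sin.
rewrite in_itv/= sin0 !subr0 => /andP[c0 cx] ->; rewrite ger0_norm// => x1.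
have := cos_lower_bound c; have := cos_le1 c => h1 h2.
rewrite -[X in _ - X]mul1r -mulrBl normrM (ger0_norm x0) ler0_norm ?subr_le0//.
have c2 : c ^+ 2 <= x ^+ 2 by rewrite lerXn2r ?nnegrE.
have h3 : - (cos c - 1) <= x ^+ 2 / 2 by lra.
have h4 : 0 <= x ^+ 2 / 2 by rewrite divr_ge0 ?sqr_ge0.
by apply: (le_trans (ler_wpM2r x0 h3)); rewrite ler_piMr.
Qed.

(** From [1 - x <= expR (- x)] follows [(1 - x) expR x <= 1], so the remainder times [1 - x] is at
    most [x ^+ 2]; and [1 - x >= 1 / 2]. *)
Lemma norm_expRB1D_le x : `|x| <= 1 / 2 -> `|expR x - 1 - x| <= 2 * x ^+ 2.
Proof.
rewrite ler_norml => /andP[xl xr].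
have h1 := expR_ge1Dx x; have h2 := expR_ge1Dx (- x).
rewrite expRN in h2.
have e0 := expR_gt0 x.
have h3 : (1 - x) * expR x <= 1.
  by rewrite -ler_pdivlMr// div1r.
rewrite ger0_norm; last lra.
have h4 : (expR x - 1 - x) * (1 - x) <= x ^+ 2.
  have -> : (expR x - 1 - x) * (1 - x) = (1 - x) * expR x - 1 + x ^+ 2 by ring.
  lra.
have h5 : 0 <= expR x - 1 - x by lra.
have h6 : (expR x - 1 - x) * (1 / 2) <= (expR x - 1 - x) * (1 - x).
  by rewrite ler_wpM2l//; lra.
lra.
Qed.

End RealEstimates.

(** * The complex modulus and the complex exponential *)

Section Normc.
Variable R : realType.
Implicit Types z h : R[i].

Lemma normc_ge0 z : 0 <= normc z.
Proof. by case: z => a b; exact: sqrtr_ge0. Qed.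

Lemma normcB z h : normc (z - h) = normc (h - z).
Proof. by rewrite -normcN opprB. Qed.

Lemma normcD_le z h : normc (z + h) <= normc z + normc h.
Proof. exact: le_normcD. Qed.

Lemma normcD2 z h (x y : R) :
  normc z <= x -> normc h <= y -> normc (z + h) <= x + y.
Proof. by move=> zx hy; rewrite (le_trans (normcD_le _ _))// lerD. Qed.

Lemma norm_Re_le z : `|complex.Re z| <= normc z.
Proof.
by case: z => a b /=; rewrite -sqrtr_sqr ler_wsqrtr // lerDl sqr_ge0.
Qed.

Lemma norm_Im_le z : `|complex.Im z| <= normc z.
Proof.
by case: z => a b /=; rewrite -sqrtr_sqr ler_wsqrtr // lerDr sqr_ge0.
Qed.

Lemma normc_le_ReIm z : normc z <= `|complex.Re z| + `|complex.Im z|.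
Proof.
case: z => a b /=; rewrite -[leRHS]ger0_norm ?addr_ge0// -sqrtr_sqr ler_wsqrtr//.
rewrite sqrrD !real_normK ?num_real// -addrA lerD2l lerDr.
by rewrite mulrn_wge0// mulr_ge0.
Qed.

Lemma normc_real (x : R) : normc x%:C = `|x|.
Proof. by rewrite /= expr0n/= addr0 sqrtr_sqr. Qed.

Lemma normc_nat (n : nat) : normc (n%:R : R[i]) = n%:R.
Proof. by rewrite -(rmorph_nat (real_complex R)) normc_real normr_nat. Qed.

Lemma normcX z n : normc (z ^+ n) = normc z ^+ n.
Proof. by elim: n => [|n IH]; rewrite ?expr0 ?normc1// !exprS normcM IH. Qed.

Lemma normc_sum (I : Type) (s : seq I) (P : pred I) (F : I -> R[i]) :
  normc (\sum_(i <- s | P i) F i) <= \sum_(i <- s | P i) normc (F i).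
Proof.
elim/big_rec2: _ => [|i y x _ xy]; first by rewrite normc0.
by rewrite (le_trans (normcD_le _ _))// lerD2l.
Qed.

Lemma normc_normr z : `|z| = (normc z)%:C.
Proof. by rewrite normc_def; case: z. Qed.

Lemma cexpD z h : cexp (z + h) = cexp z * cexp h.
Proof.
case: z => a b; case: h => c d; rewrite /cexp /= expRD cosD sinD.
by apply/eqP; rewrite eq_complex /=; apply/andP; split; apply/eqP; ring.
Qed.

Lemma cexp_real (x : R) : cexp (x%:C) = (expR x)%:C.
Proof. by rewrite /cexp /= cos0 sin0 mulr1 mulr0. Qed.

Lemma normc_cexp z : normc (cexp z) = expR (complex.Re z).
Proof.
rewrite /= !exprMn -mulrDr cos2Dsin2 mulr1 sqrtr_sqr ger0_norm//.
Qed.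

Lemma normc_cexpN_le (x : R) z : 0 <= x <= 1 ->
  normc (cexp (- (x%:C * z))) <= expR (normc z).
Proof.
move=> /andP[x0 x1]; rewrite normc_cexp ler_expR (le_trans (ler_norm _))//.
rewrite (le_trans (norm_Re_le _))// normcN normcM normc_real ger0_norm//.
by rewrite ler_piMl// normc_ge0.
Qed.

(** Real and imaginary parts are bounded separately, each by [3 |h|^2]. *)
Lemma cexp_taylor h : normc h <= 1 / 2 ->
  normc (cexp h - 1 - h) <= 6 * normc h ^+ 2.
Proof.
move=> hr; have := norm_Re_le h; have := norm_Im_le h.
have r0 := normc_ge0 h.
move=> hi hre; apply: le_trans (normc_le_ReIm _) _; move: hi hre.
move: (normc h) hr r0 => r hr r0; case: h => a b /=.
rewrite !oppr0 !addr0 => br ar.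
have a2 : `|a| <= 1 / 2 by apply: le_trans hr.
have b1 : `|b| <= 1 by apply: (le_trans br); lra.
have ha := norm_expRB1D_le a2; have hb := norm_sinB_le b1.
have hc := cos_lower_bound b; have hc' := cos_le1 b.
have e0 := expR_gt0 a.
move: ha hb hc hc' e0 a2 b1 br ar.
move: (expR a) (sin b) (cos b) => e s c.
rewrite !ler_norml => /andP[ha1 ha2] /andP[hb1 hb2] hc1 hc2 e0.
move=> /andP[? ?] /andP[? ?] /andP[? ?] /andP[? ?].
have a2r : a ^+ 2 <= r ^+ 2 by nra.
have b2r : b ^+ 2 <= r ^+ 2 by nra.
have e2 : e <= 2 by nra.
(* Split as [(e - 1 - a) - e * (1 - c)], with terms of size at most [2 r^2] and [r^2]. *)
have H1 : `|e * c - 1 - a| <= 3 * r ^+ 2.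
  have : 0 <= e * (1 - c) <= r ^+ 2 by apply/andP; split; nra.
  move=> /andP[? ?]; rewrite ler_norml; apply/andP; split; nra.
have H2 : `|e * s - b| <= 3 * r ^+ 2.
  have k1 : `|e * (s - b)| <= r ^+ 2.
    rewrite ler_norml; apply/andP; split; nra.
  have k2 : `|b * (e - 1)| <= 2 * r ^+ 2.
    rewrite normrM; have : `|e - 1| <= 2 * r.
      by rewrite ler_norml; apply/andP; split; nra.
    have : `|b| <= r by rewrite ler_norml; apply/andP.
    have := normr_ge0 b; have := normr_ge0 (e - 1).
    by move: `|b| `|e - 1| => p q ? ? ? ?; nra.
  have -> : e * s - b = e * (s - b) + b * (e - 1) by ring.
  by apply: (le_trans (ler_normD _ _)); lra.
lra.
Qed.

End Normc.

(** * Convergence of complex sequences *)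

Section ComplexLimits.
Variable R : realType.

(** Radii in the topology of [Cplx R] are positive complex numbers, hence real; with radii in [R],
    real arithmetic applies. *)
Lemma cvg_normcP (T : Type) (F : set_system T) (FF : Filter F)
    (f : T -> Cplx R) (l : Cplx R) :
  f t @[t --> F] --> l <->
  forall e : R, 0 < e -> \forall t \near F, normc (l - f t) < e.
Proof.
split=> [/cvgrPdist_lt fl e e0|fl].
  have e0' : 0 < (e%:C : Cplx R) by rewrite ltcR.
  by apply: filterS (fl _ e0') => t; rewrite normc_normr ltcR.
apply/cvgrPdist_lt => e; rewrite ltcE => /andP[/= /eqP e1 e2].
apply: filterS (fl _ e2) => t.
by rewrite normc_normr ltcE /= e1 eqxx.
Qed.

(** Completeness of [R] is applied to the real and imaginary parts, both dominated by the
    modulus. *)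
Lemma normc_cauchy_cvg (u : nat -> Cplx R) :
  (forall e : R, 0 < e -> exists m, forall n, (m <= n)%N ->
     normc (u n - u m) < e) ->
  exists l : Cplx R, u n @[n --> \oo] --> l.
Proof.
move=> cu.
have real_cvg (g : R[i] -> R) : (forall z w, g (z - w) = g z - g w) ->
    (forall z, `|g z| <= normc z) -> exists l : R, g (u n) @[n --> \oo] --> l.
  move=> gB gn; suff /cvg_ex[l ?] : cvg (g (u n) @[n --> \oo]) by exists l.
  apply/cauchy_cvgP/cauchy_exP => e e0.
  have [m mP] := cu e e0; exists (g (u m)); exists m => // n /= mn.
  by rewrite /ball/= distrC -gB; exact: le_lt_trans (mP _ mn).
have [a ua] := real_cvg (@complex.Re R) (fun z w =>
  ltac:(by case: z; case: w)) (@norm_Re_le R).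
have [b ub] := real_cvg (@complex.Im R) (fun z w =>
  ltac:(by case: z; case: w)) (@norm_Im_le R).
exists (a +i* b); apply/cvg_normcP => e e0.
have e20 : 0 < e / 2 by rewrite divr_gt0.
move/cvgrPdist_lt : ua => /(_ _ e20) ua.
move/cvgrPdist_lt : ub => /(_ _ e20) ub.
near=> n; apply: le_lt_trans (normc_le_ReIm _) _.
have : `|a - complex.Re (u n)| < e / 2 by near: n.
have : `|b - complex.Im (u n)| < e / 2 by near: n.
by case: (u n) => c d /=; lra.
Unshelve. all: by end_near. Qed.

Lemma cvg_limC (u : nat -> Cplx R) (l : Cplx R) :
  u n @[n --> \oo] --> l -> limn u = l.
Proof. exact: cvg_lim. Qed.

End ComplexLimits.

(** * Convergence of infinite products *)

Section InfiniteProduct.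
Variable R : realType.
Implicit Types u : nat -> R[i].

Lemma sum_geometric_le (c : R) (m n : nat) : 0 <= c ->
  \sum_(m <= k < n) c / 2 ^+ k <= c * 2 / 2 ^+ m.
Proof.
move=> c0; have [nm|mn] := leqP n m.
  by rewrite big_geq// divr_ge0// ?mulr_ge0// exprn_ge0.
suff -> : \sum_(m <= k < n) c / 2 ^+ k = c * 2 / 2 ^+ m - c * 2 / 2 ^+ n.
  by rewrite gerBl divr_ge0 ?mulr_ge0 ?exprn_ge0.
rewrite -opprB -(telescope_sumr (fun k => c * 2 / 2 ^+ k) (ltnW mn)) -sumrN.
by apply: eq_bigr => k _; rewrite exprS; field.
Qed.

(** Induction through [q u - 1 = (q - 1) + q (u - 1)]: the bound 1/4 on the sums keeps [|q| <= 2],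
    so a new factor adds at most [2 a]. *)
Lemma normc_prodB1_le u (a : nat -> R) (m n : nat) :
  (forall k, (m <= k)%N -> normc (u k - 1) <= a k) ->
  (forall k, \sum_(m <= j < k) a j <= 1 / 4) ->
  normc (\prod_(m <= k < n) u k - 1) <= 2 * \sum_(m <= k < n) a k.
Proof.
move=> ua a4; elim: n => [|n IH].
  by rewrite !big_geq// subrr normc0 mulr0.
have [mn|nm] := leqP m n; last by rewrite !big_geq// subrr normc0 mulr0.
rewrite !big_nat_recr//=.
have := a4 n; have := ua _ mn.
move: (\sum_(m <= k < n) _) (\prod_(m <= k < n) _) IH => s q IH un sn.
have -> : q * u n - 1 = (q - 1) + ((q - 1) + 1) * (u n - 1) by ring.
apply: le_trans (normcD_le _ _) _; rewrite normcM.
have : normc (q - 1 + 1) <= 2.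
  by apply: le_trans (normcD_le _ _) _; rewrite normc1; lra.
have := normc_ge0 (u n - 1).
by move: (normc (u n - 1)) (normc (q - 1)) (normc (q - 1 + 1)) un IH => *; nra.
Qed.

(** From a rank [m] where the geometric tail is at most 1/4, the partial products stay within 1/2 of
    1; they are Cauchy, and their limit cannot be 0. *)
Lemma infprod_cvg_geometric (u : nat -> Cplx R) (c : R) (m0 : nat) : 0 <= c ->
  (forall k, (m0 <= k)%N -> normc (u k - 1) <= c / 2 ^+ k) -> infprod_cvg u.
Proof.
move=> c0 uc.
have small (e : R) : 0 < e -> exists2 m, (m0 <= m)%N & c * 2 / 2 ^+ m <= e.
  move=> e0; exists (maxn m0 (Num.bound (e^-1 * (c * 2)))); first exact: leq_maxl.
  rewrite ler_pdivrMr ?exprn_gt0// -ler_pdivrMl//.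
  apply: (le_trans (ltW (archi_boundP _))).
    by rewrite !mulr_ge0// invr_ge0 ltW.
  rewrite -natrX ler_nat (leq_trans (leq_maxr m0 _))// ltnW// ltn_expl//.
have [m mm0 mc] := small (1 / 4) ltac:(by lra).
have sum4 p k : (m <= p)%N -> \sum_(p <= j < k) c / 2 ^+ j <= 1 / 4.
  move=> mp; apply: le_trans (sum_geometric_le _ _ c0) _; apply: le_trans mc.
  rewrite ler_wpM2l ?mulr_ge0// lef_pV2 ?posrE ?exprn_gt0//.
  by rewrite ler_weXn2l// ler1n.
have prod_le p n : (m <= p)%N ->
    normc (\prod_(p <= k < n) u k - 1) <= 2 * (c * 2 / 2 ^+ p).
  move=> mp; apply: (@le_trans _ _ (2 * \sum_(p <= k < n) c / 2 ^+ k)).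
    apply: (normc_prodB1_le (a := fun k => c / 2 ^+ k)) => k; last exact: sum4.
    by move=> pk; apply: uc; rewrite (leq_trans mm0)// (leq_trans mp).
  by rewrite ler_wpM2l// sum_geometric_le.
have mc2 : 2 * (c * 2 / 2 ^+ m) <= 1 / 2 by lra.
have [|q uq] := @normc_cauchy_cvg R (fun n => \prod_(m <= k < n) u k).
  move=> e e0; have [p _ pe] := small (e / 8) ltac:(by lra).
  have pe' : c * 2 / 2 ^+ (maxn m p) <= e / 8.
    apply: le_trans pe.
    rewrite ler_wpM2l ?mulr_ge0// lef_pV2 ?posrE ?exprn_gt0//.
    by rewrite ler_weXn2l ?leq_maxr// ler1n.
  exists (maxn m p) => n pn.
  (* Cutting at [maxn m p] gives the difference [v * (w - 1)], with [|v| <= 2] and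
     [|w - 1| <= e / 4]. *)
  rewrite (@big_cat_nat _ _ _ (maxn m p)) ?leq_maxl//=.
  rewrite -[X in _ - X]mulr1 -mulrBr normcM.
  have := prod_le (maxn m p) n (leq_maxl _ _).
  have := prod_le m (maxn m p) (leqnn _).
  set v := \prod_(m <= _ < _) _; set w := \prod_(_ <= _ < n) _ => hv hw.
  have v2 : normc v <= 2.
    by rewrite -[v](subrK 1) (le_trans (normcD_le _ _))// normc1; lra.
  apply: le_lt_trans (_ : 2 * (e / 4) < e); last by lra.
  by rewrite ler_pM ?normc_ge0//; lra.
exists m; split.
  (* A zero factor is at distance 1 from 1, whereas [c / 2 ^+ k], a single term of the tail, is at
     most 1/4. *)
  move=> k mk; apply/eqP => uk0; have := prod_le k k.+1 mk.
  have := prod_le m m.+1 (leqnn _).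
  have := uc k (leq_trans mm0 mk); rewrite uk0 sub0r normcN normc1 => h.
  have := sum4 k k.+1 mk; rewrite big_nat1; lra.
(* A zero limit would put some partial product at distance less than 1/2 from 0 and at most 1/2 from
   1. *)
exists q => //; apply/eqP => q0; subst q.
move/cvg_normcP : uq => /(_ _ (ltac:(lra) : 0 < 1 / 2 :> R)).
move=> [n _ /(_ n (leqnn _))] /=.
rewrite sub0r normcN => h; have := prod_le m n (leqnn _) => h'.
move: h h'; set v := \prod_(m <= k < n) u k => h h'.
have := normcD_le v (- (v - 1)); rewrite normcN.
have -> : v + - (v - 1) = 1 by ring.
by rewrite normc1; lra.
Qed.

Lemma infprod_cvgP (u : nat -> Cplx R) : infprod_cvg u ->
  (\prod_(0 <= k < n) u k : Cplx R) @[n --> \oo] --> infprod u.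
Proof.
move=> [m [_ [q _ /cvg_normcP uq]]].
suff ul : (\prod_(0 <= k < n) u k : Cplx R) @[n --> \oo] -->
    ((\prod_(0 <= k < m) u k) * q : Cplx R).
  by rewrite /infprod (cvg_limC ul).
apply/cvg_normcP => e e0.
set v := \prod_(0 <= k < m) u k.
have v0 := normc_ge0 v.
(* The [+ 1] covers a vanishing head product [v]. *)
have e1 : 0 < e / (normc v + 1) by rewrite divr_gt0// ltr_wpDl.
near=> n; rewrite (@big_cat_nat _ _ _ m) //=; last by near: n; exists m.
rewrite -/v -mulrBr normcM.
have : normc (q - \prod_(m <= k < n) u k) < e / (normc v + 1).
  by near: n; exact: uq.
rewrite ltr_pdivlMr ?ltr_wpDl// mulrDr mulr1 mulrC.
by have := normc_ge0 (q - \prod_(m <= k < n) u k); lra.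
Unshelve. all: by end_near. Qed.

End InfiniteProduct.

(** * Differentiability of a limit under uniform Taylor remainders *)

Section LimitOfTaylor.
Variable R : realType.

(* The [D n] form a Cauchy sequence: dividing the bounds by a small fixed [h]
   compares [D n - D m] with differences of values, up to [2 M |h|]. *)
Lemma derivable_limit (F : nat -> Cplx R -> Cplx R) (f : Cplx R -> Cplx R)
    (D : nat -> Cplx R) (z : Cplx R) (M : R) : 0 <= M ->
  (forall w, F n w @[n --> \oo] --> f w) ->
  (forall n (h : R[i]), normc h <= 1 / 2 ->
     normc (F n (h + z) - F n z - h * D n) <= M * normc h ^+ 2) ->
  derivable f z 1.
Proof.
move=> M0 Ff FD.
have Fnear w (e : R) : 0 < e -> \forall n \near \oo, normc (f w - F n w) < e.
  by move=> e0; move/cvg_normcP : (Ff w); exact.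
have [|L DL] := @normc_cauchy_cvg R D.
  move=> e e0.
  (* The first entry admits the Taylor bound at increment [t]; the second gives
     [M * t ^+ 2 <= t * e / 8]. Two remainders and four value differences, each at most [t * e / 8],
     sum to less than [t * e]. *)
  pose t := Num.min (1 / 2) (e / (8 * (M + 1))).
  have t0 : 0 < t.
    by rewrite lt_min divr_gt0//= divr_gt0// mulr_gt0// ltr_wpDl.
  have t2 : t <= 1 / 2 by rewrite ge_min lexx.
  have tM : M * t <= e / 8.
    have : t <= e / (8 * (M + 1)) by rewrite ge_min lexx orbT.
    by rewrite ler_pdivlMr ?mulr_gt0 ?ltr_wpDl// => h; nra.
  have te0 : 0 < t * e / 8 by rewrite divr_gt0// mulr_gt0.
  have [m _ mP] := filterI (Fnear (t%:C + z) _ te0) (Fnear z _ te0).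
  exists m => n mn.
  have nt : normc (t%:C : R[i]) = t by rewrite normc_real gtr0_norm.
  have [/= a1 a2] := mP n mn; have [/= b1 b2] := mP m (leqnn _).
  have := FD n t%:C; rewrite nt normcB => /(_ t2) c1.
  have := FD m t%:C; rewrite nt => /(_ t2) c2.
  rewrite (normcB (f (_ + z))) in a1; rewrite (normcB (f z) (F m z)) in b2.
  rewrite -(ltr_pM2l t0) -[X in X * _]nt -normcM.
  have -> : t%:C * (D n - D m) = (F m (t%:C + z) - F m z - t%:C * D m)
      + (t%:C * D n - (F n (t%:C + z) - F n z))
      + (F n (t%:C + z) - f (t%:C + z)) + (f (t%:C + z) - F m (t%:C + z))
      + (f z - F n z) + (F m z - f z) by ring.
  apply: le_lt_trans (normcD2 (normcD2 (normcD2 (normcD2 (normcD2 c2 c1)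
    (ltW a1)) (ltW b1)) (ltW a2)) (ltW b2)) _.
  have : M * t ^+ 2 <= t * e / 8 
    by have := ler_wpM2l (ltW t0) tM; lra.
  by have := mulr_gt0 t0 e0; lra.
(* The remainder bound passes to the limit: replacing the values and [D n] by their limits costs
   less than an arbitrary [e]. *)
have fT (h : R[i]) : normc h <= 1 / 2 ->
    normc (f (h + z) - f z - h * L) <= M * normc h ^+ 2.
  move=> h2; apply/ler_addgt0Pr => e e0.
  have e4 : 0 < e / 4 by lra.
  have Dn : \forall n \near \oo, normc (L - D n) < e / 4.
    by move/cvg_normcP : DL; exact.
  have := filterI (filterI (Fnear (h + z) _ e4) (Fnear z _ e4)) Dn.
  move=> [n _ /(_ n (leqnn _)) /= [[a1 a2] a3]].
  rewrite normcB in a2; rewrite normcB in a3.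
  have a4 : normc (h * (D n - L)) <= 1 / 2 * (e / 4).
    by rewrite normcM ler_pM ?normc_ge0// ltW.
  have -> : f (h + z) - f z - h * L = (F n (h + z) - F n z - h * D n)
      + (f (h + z) - F n (h + z)) + (F n z - f z) + h * (D n - L) by ring.
  apply: le_trans (normcD2 (normcD2 (normcD2 (FD n h h2) (ltW a1)) (ltW a2)) a4) _.
  lra.
rewrite /derivable; apply/cvg_ex; exists L; apply/cvg_normcP => e e0.
(* Dividing the remainder by [h] leaves [M * |h|], below [e] once [|h| < e / (M + 1)]; the [+ 1]
   covers [M = 0]. *)
pose d := Num.min (1 / 2) (e / (M + 1)).
have d0 : 0 < d by rewrite lt_min divr_gt0//= divr_gt0// ltr_wpDl.
have d0C : 0 < (d%:C : Cplx R) by rewrite ltcR.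
near=> h.
have h0 : h != 0 by near: h; exact: nbhs_dnbhs_neq.
have : `|h| < (d%:C : Cplx R) by near: h; exact: dnbhs0_lt.
rewrite normc_normr ltcR lt_min => /andP[/ltW h2 he].
have := fT h h2.
have h0' : 0 < normc h.
  by rewrite lt_def normc_ge0 andbT; apply: contra_neq h0 => /eq0_normc.
have -> : L - h^-1 *: ((f \o shift z) (h *: 1) - f z) =
    - h^-1 * (f (h + z) - f z - h * L).
  rewrite /= [h *: _]mulr1 [_ *: _]/(_ * _).
  by rewrite mulrBr !mulNr mulrA mulVf// mul1r opprK addrC.
rewrite normcM normcN normcV => fh.
rewrite mulrC ltr_pdivrMr//; apply: le_lt_trans fh _.
rewrite expr2 mulrA ltr_pM2r//.
move: he; rewrite ltr_pdivlMr ?ltr_wpDl// => he.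
by lra.
Unshelve. all: by end_near. Qed.

End LimitOfTaylor.

(** * Partial products as mixtures of exponentials, and their limit *)

Section CantorProduct.
Variables (R : realType) (N : nat) (alpha : 'I_N -> R).
Hypotheses (N2 : (2 <= N)%N) (alpha_simplex : simplex alpha).

Let alpha_ge0 n : 0 <= alpha n. Proof. exact: alpha_simplex.1. Qed.

Lemma cantor_factorS (z : Cplx R) (k : nat) :
  cantor_factor alpha z k.+1 = cantor_factor alpha (z / N%:R : Cplx R) k.
Proof.
apply: eq_bigr => n _; rewrite exprS.
have -> // : n%:R * z / (N%:R * N%:R ^+ k) =
    n%:R * (z / N%:R) / (N%:R ^+ k) :> Cplx R.
by rewrite invfM !mulrA.
Qed.

(** Splitting off the first factor leaves the product at [z / N], the same recursion as for the
    Laplace transform of the self-similar measure. *)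
Lemma cantor_partial_productS (z : Cplx R) (n : nat) :
  \prod_(0 <= k < n.+1) cantor_factors alpha z k =
  cantor_factor alpha z 1 *
    \prod_(0 <= k < n) cantor_factors alpha (z / N%:R : Cplx R) k.
Proof.
rewrite big_nat_recl//; congr (_ * _).
by apply: eq_bigr => k _; rewrite /cantor_factors cantor_factorS.
Qed.

(* [I] is the set of words of length [n] over ['I_N], [p] the weight of a word
   and [x] its value read as a base-[N] fraction. *)
Lemma cantor_partial_product_mixture (n : nat) :
  exists (I : finType) (p x : I -> R),
    [/\ forall i, 0 <= p i, \sum_i p i = 1, forall i, 0 <= x i <= 1 &
    forall z : Cplx R, \prod_(0 <= k < n) cantor_factors alpha z k =
      \sum_i (p i)%:C * cexp (- ((x i)%:C * z))].
Proof.
elim: n => [|n [I [p [x [p0 p1 x01 E]]]]].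
  exists unit, (fun=> 1), (fun=> 0); split => //.
  - by rewrite big_const card_unit /= addr0.
  - by move=> _; rewrite lexx ler01.
  move=> z; rewrite big_geq// big_const card_unit /= addr0.
  rewrite rmorph0 mul0r oppr0 -(rmorph0 (real_complex R)) cexp_real.
  by rewrite expR0 mulr1.
have N0 : 0 < N%:R :> R by rewrite ltr0n (leq_trans _ N2).
(* The factor split off supplies the leading digit [j.1]; as it is at most [N - 1], the new value
   stays at most 1. *)
exists ('I_N * I)%type, (fun j => alpha j.1 * p j.2),
  (fun j : 'I_N * I => (j.1%:R + x j.2) / N%:R); split.
- by move=> j; rewrite mulr_ge0.
- rewrite -(pair_bigA _ (fun i j => alpha i * p j))/=.
  under eq_bigr do rewrite -mulr_sumr p1 mulr1.
  exact: alpha_simplex.2.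
- move=> [i j] /=; have /andP[x0 x1] := x01 j.
  rewrite divr_ge0 ?addr_ge0// ler_pdivrMr// mul1r.
  apply: (@le_trans _ _ (i%:R + 1)); first by rewrite lerD2l.
  by rewrite -(natrD _ i 1) ler_nat addn1 ltn_ord.
move=> z; rewrite cantor_partial_productS E big_distrlr/=.
rewrite (pair_bigA _ (fun i j =>
  (alpha i)%:C * cexp (- (i%:R * z / N%:R ^+ 1)) *
  ((p j)%:C * cexp (- ((x j)%:C * (z / N%:R))))))/=.
apply: eq_bigr => -[i j] _ /=; rewrite mulrACA -cexpD rmorphM/=.
congr (_ * cexp _); rewrite fmorph_div rmorphD/= !rmorph_nat expr1.
by ring.
Qed.

(** [D] is the derivative of the mixture. By convexity one exponential suffices: its remainder is
    [e^(-xz)] times that of [e^(-xh)] at 0, and [0 <= x <= 1] makes the constant independent of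
    [n]. *)
Lemma cantor_partial_product_taylor (n : nat) (z : Cplx R) :
  exists D : Cplx R, forall h : R[i], normc h <= 1 / 2 ->
  normc (\prod_(0 <= k < n) cantor_factors alpha (h + z : Cplx R) k -
    \prod_(0 <= k < n) cantor_factors alpha z k - h * D) <=
  6 * expR (normc z) * normc h ^+ 2.
Proof.
have [I [p [x [p0 p1 x01 E]]]] := cantor_partial_product_mixture n.
exists (\sum_i (p i)%:C * (- (x i)%:C * cexp (- ((x i)%:C * z)))) => h h2.
rewrite !E mulr_sumr -!sumrB.
apply: (le_trans (normc_sum _ _ _)).
rewrite -[leRHS]mul1r -[X in _ <= X * _]p1 mulr_suml; apply: ler_sum => i _.
have /andP[x0 x1] := x01 i.
have -> : (p i)%:C * cexp (- ((x i)%:C * (h + z))) -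
    (p i)%:C * cexp (- ((x i)%:C * z)) -
    h * ((p i)%:C * (- (x i)%:C * cexp (- ((x i)%:C * z)))) =
    (p i)%:C * (cexp (- ((x i)%:C * z)) *
      (cexp (- ((x i)%:C * h)) - 1 - (- ((x i)%:C * h)))).
  by rewrite mulrDr opprD cexpD; ring.
rewrite normcM normc_real ger0_norm// ler_wpM2l// normcM.
have xh : normc (- ((x i)%:C * h)) <= normc h.
  by rewrite normcN normcM normc_real ger0_norm// ler_piMl// normc_ge0.
rewrite -[leRHS]mulrA [leRHS]mulrCA; apply: ler_pM; rewrite ?normc_ge0//.
  exact: normc_cexpN_le.
apply: (le_trans (cexp_taylor (le_trans xh h2))).
by rewrite ler_wpM2l// lerXn2r ?nnegrE ?normc_ge0.
Qed.

(** Uniformity in [n] lets the partial product be absorbed in the limit that identifies the Laplace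
    transform. *)
Lemma normc_cantor_partial_product_le (n : nat) (z : Cplx R) :
  normc (\prod_(0 <= k < n) cantor_factors alpha z k) <= expR (normc z).
Proof.
have [I [p [x [p0 p1 x01 E]]]] := cantor_partial_product_mixture n.
rewrite E; apply: (le_trans (normc_sum _ _ _)).
rewrite -[leRHS]mul1r -[X in _ <= X * _]p1 mulr_suml; apply: ler_sum => i _.
by rewrite normcM normc_real ger0_norm// ler_wpM2l// normc_cexpN_le.
Qed.

(** As the weights sum to 1, a factor minus 1 is the convex combination of the [cexp w - 1], with
    [w] geometrically small. *)
Lemma cantor_factors_cvg (z : Cplx R) : infprod_cvg (cantor_factors alpha z).
Proof.
(* [N] bounds the digit, and 4 gives [|w| <= c / 2 ^+ k / 4 <= 1 / 4], whence
   [|w| + 6 |w|^2 <= c / 2 ^+ k]. The rank [Num.bound c] ensures [c <= 2 ^+ k]. *)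
pose c := 4 * (N%:R * normc z).
have c0 : 0 <= c by rewrite !mulr_ge0// normc_ge0.
apply: (infprod_cvg_geometric (c := c) (m0 := Num.bound c)) => // k ck.
have cS : normc (z / N%:R ^+ k.+1) * N%:R <= c / 4 / 2 ^+ k.
  rewrite normcM normcV normcX normc_nat /c.
  have -> : 4 * (N%:R * normc z) / 4 / 2 ^+ k = normc z / 2 ^+ k * N%:R.
    by field.
  rewrite ler_wpM2r// ler_wpM2l ?normc_ge0//.
  rewrite lef_pV2 ?posrE ?exprn_gt0//; last by rewrite ltr0n (leq_trans _ N2).
  rewrite exprS (@le_trans _ _ (N%:R ^+ k))//.
    by rewrite lerXn2r ?nnegrE// ler_nat.
  rewrite ler_peMl ?exprn_ge0// ler1n; exact: leq_trans N2.
have ck1 : c / 2 ^+ k <= 1.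
  rewrite ler_pdivrMr ?exprn_gt0// mul1r.
  apply: (le_trans (ltW (archi_boundP c0))).
  by rewrite -natrX ler_nat (leq_trans ck)// ltnW// ltn_expl.
have -> : cantor_factors alpha z k - 1 = \sum_(n < N) (alpha n)%:C *
    (cexp (- (n%:R * z / N%:R ^+ k.+1)) - 1).
  under [RHS]eq_bigr do rewrite mulrBr mulr1.
  by rewrite sumrB -rmorph_sum alpha_simplex.2 rmorph1.
apply: (le_trans (normc_sum _ _ _)).
rewrite -[leRHS]mul1r -[X in _ <= X * _]alpha_simplex.2 mulr_suml.
apply: ler_sum => n _.
rewrite normcM normc_real ger0_norm// ler_wpM2l//.
set w := - _.
have wc : normc w <= c / 2 ^+ k / 4.
  have -> : c / 2 ^+ k / 4 = c / 4 / 2 ^+ k by rewrite mulrAC.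
  apply: le_trans cS; rewrite /w normcN -mulrA normcM normc_nat mulrC.
  by rewrite ler_wpM2l ?normc_ge0// ler_nat ltnW.
have w2 : normc w <= 1 / 2 by lra.
rewrite -[cexp w - 1](subrK w); apply: (le_trans (normcD_le _ _)).
have := cexp_taylor w2; have := normc_ge0 w.
by move: (normc w) (normc (_ - _)) (c / 2 ^+ k) wc w2 ck1 => *; nra.
Qed.

Lemma cantor_partial_product_cvg (z : Cplx R) :
  (\prod_(0 <= k < n) cantor_factors alpha z k : Cplx R) @[n --> \oo] -->
  cantor_product alpha z.
Proof. exact/infprod_cvgP/cantor_factors_cvg. Qed.

Lemma entire_cantor_product : entire (cantor_product alpha).
Proof.
move=> z; have /choice[D DP] := cantor_partial_product_taylor^~ z.
apply: (derivable_limit (D := D) (M := 6 * expR (normc z))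
  (F := fun n w => \prod_(0 <= k < n) cantor_factors alpha w k)) => //.
exact: cantor_partial_product_cvg.
Qed.

End CantorProduct.

(** * The Laplace transform of the Cantor measure *)

Section CantorLaplace.
Variables (R : realType) (N : nat) (alpha : 'I_N -> R).
Hypotheses (N2 : (2 <= N)%N) (alpha_simplex : simplex alpha).
Variable mu : probability (measurableTypeR R) R.
Hypothesis mu_cantor : weighted_cantor_measure alpha mu.

Let alpha_ge0 n : 0 <= alpha n. Proof. exact: alpha_simplex.1. Qed.

Let A : set (measurableTypeR R) := `[0, 1]%classic.

Let mA : measurable A. Proof. exact: measurable_itv. Qed.

Let g (s : R) : measurableTypeR R -> \bar R := fun x => (expR (- (s * x)))%:E.

Let g_measurable s (D : set (measurableTypeR R)) : measurable_fun D (g s).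
Proof.
apply/measurable_EFinP/measurable_funTS.
apply: continuous_measurable_fun => x.
apply: continuous_comp; last exact: continuous_expR.
by apply: continuousN; apply: cvgM; [exact: cvg_cst|exact: cvg_id].
Qed.

Let g_ge0 s x : (0 <= g s x)%E.
Proof. by rewrite lee_fin expR_ge0. Qed.

Let mu_A : mu A = 1%E.
Proof.
have := probability_setC mu mA; rewrite mu_cantor.1.
have : (mu A \is a fin_num)%E by exact: fin_num_measure.
case: (mu A) => // r _ /eqP; rewrite -EFinB eqe => /eqP r1.
by congr _%:E; lra.
Qed.

(** The complement of [A] is null. Changing variables by [cantor_map] is simplest on the whole line,
    which is its own preimage. *)
Let integral_setT s : (\int[mu]_x g s x = \int[mu]_(x in A) g s x)%E.
Proof.
rewrite -(setUv A) ge0_integral_setU//=; first last.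
- exact/disj_set2P/setICr.
- exact: measurableC.
rewrite [X in (_ + X)%E]null_set_integral ?adde0//; last exact: mu_cantor.1.
exact: measurableC.
Qed.

Let in_A x : A x -> 0 <= x <= 1. Proof. by rewrite /A/= in_itv. Qed.

Let norm_expR_le (t x : R) : 0 <= x <= 1 -> `|- (t * x)| <= `|t|.
Proof.
by move=> /andP[x0 x1]; rewrite normrN normrM (ger0_norm x0) ler_piMr.
Qed.

(** The integral is finite, since the integrand is at most [expR |s|] on [A]. *)
Let laplaceE s : ((laplace mu s)%:E = \int[mu]_(x in A) g s x)%E.
Proof.
rewrite /laplace /Rintegral fineK// ge0_fin_numE; last exact: integral_ge0.
apply: (@le_lt_trans _ _ (\int[mu]_(x in A) (cst (expR `|s|)%:E) x)%E).
  apply: ge0_le_integral => // [|x /in_A x01]; first exact: g_measurable.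
  by rewrite lee_fin ler_expR (le_trans (ler_norm _))// norm_expR_le.
by rewrite integral_cst// [X in (_ * X)%E]mu_A mule1 ltry.
Qed.

(** On [A], of mass 1, the integrand lies between [1 - 2 |t|] and [1 + 2 |t|]; the lower constant is
    nonnegative, as comparing nonnegative integrals requires. *)
Lemma laplace_near0 t : `|t| <= 1 / 2 -> `|laplace mu t - 1| <= 2 * `|t|.
Proof.
move=> t2.
have expRB x : 0 <= x <= 1 -> `|expR (- (t * x)) - 1| <= 2 * `|t|.
  move=> x01; have := norm_expR_le t x01; move: (- _) => y yt.
  have y2 : `|y| <= 1 / 2 by exact: le_trans t2.
  have := norm_expRB1D_le y2; rewrite -[y ^+ 2]real_normK ?num_real//.
  move=> h; rewrite -[X in `|X|](subrK y) (le_trans (ler_normD _ _))//.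
  by have := normr_ge0 y; move: `|_ - _| `|y| y2 yt h => *; nra.
rewrite ler_norml; apply/andP; split.
  rewrite lerBrDl -lee_fin laplaceE -[leLHS]mule1 -mu_A -integral_cst//.
  apply: ge0_le_integral => //.
    by move=> x _; rewrite lee_fin; lra.
  move=> x /in_A/expRB; rewrite ler_norml => /andP[]; rewrite lee_fin; lra.
rewrite lerBlDl -lee_fin laplaceE -[leRHS]mule1 -mu_A -integral_cst//.
apply: ge0_le_integral => // x /in_A/expRB.
by rewrite ler_norml => /andP[]; rewrite lee_fin; lra.
Qed.

Let cantor_map_measurable n :
  measurable_fun [set: measurableTypeR R]
    (cantor_map N n : _ -> measurableTypeR R).
Proof.
apply: continuous_measurable_fun => x.
apply: cvgM; last exact: cvg_cst.
by apply: cvgD; [exact: cvg_id|exact: cvg_cst].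
Qed.

Let image_measure (n : nat) : {measure set (measurableTypeR R) -> \bar R}.
Proof.
refine (pushforward mu (cantor_map N n : _ -> measurableTypeR R)).
exact: cantor_map_measurable.
Defined.

(** [alpha] extended by 0, because [msum] takes measures indexed by [nat]; only indices below [N]
    are summed. *)
Let weight (k : nat) : R := if insub k is Some i then alpha i else 0.

Let weightE (i : 'I_N) : weight i = alpha i.
Proof. by rewrite /weight valK. Qed.

Let weight_ge0 k : 0 <= weight k.
Proof. by rewrite /weight; case: insub. Qed.

(** Self-similarity says that [mu] is the sum of the first [N] pieces. *)
Let piece (k : nat) : {measure set (measurableTypeR R) -> \bar R} :=
  mscale (NngNum (weight_ge0 k)) (image_measure k).

(** Integrate against the sum of pieces and change variables: [e^(-s(x+n)/N)] splits into
    [e^(-ns/N)] and the integrand at [s / N]. *)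
Lemma laplace_cantor_map s : laplace mu s =
  (\sum_(n < N) alpha n * expR (- (n%:R * s / N%:R))) * laplace mu (s / N%:R).
Proof.
have N0 : N%:R != 0 :> R by rewrite pnatr_eq0 -lt0n (leq_trans _ N2).
apply: EFin_inj; rewrite EFinM laplaceE -integral_setT.
rewrite (eq_measure_integral (msum piece N)); last first.
  move=> E mE _; apply: (etrans (mu_cantor.2 _ mE)).
  by apply: eq_bigr => i _; rewrite /= /mscale/= weightE.
rewrite ge0_integral_measure_sum//.
rewrite -sumEFin ge0_sume_distrl; last first.
  by move=> i _; rewrite lee_fin mulr_ge0// expR_ge0.
apply: eq_bigr => i _.
rewrite ge0_integral_mscale//= weightE ge0_integral_pushforward//.
rewrite preimage_setT EFinM -muleA; congr (_ * _)%E.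
rewrite laplaceE -integral_setT -ge0_integralZl//.
apply: eq_integral => x _; rewrite /g /= -EFinM -expRD.
congr (expR _)%:E; rewrite /cantor_map; by field.
Qed.

Lemma laplace_cantor_partial_product (n : nat) (s : R) : (laplace mu s)%:C =
  (\prod_(0 <= k < n) cantor_factors alpha (s%:C : Cplx R) k) *
    (laplace mu (s / N%:R ^+ n))%:C.
Proof.
elim: n s => [|n IH] s; first by rewrite big_geq// mul1r expr0 divr1.
rewrite cantor_partial_productS laplace_cantor_map rmorphM/=.
rewrite (IH (s / N%:R)) mulrA fmorph_div/= rmorph_nat.
have -> : s / N%:R / N%:R ^+ n = s / N%:R ^+ n.+1.
  by rewrite exprS invfM mulrA.
congr (_ * _ * _); rewrite rmorph_sum; apply: eq_bigr => i _.
by rewrite rmorphM/= -cexp_real rmorphN/= fmorph_div/= rmorphM/= !rmorph_nat expr1.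
Qed.

(** The error of the [n]-th partial product is that product, bounded by [expR |s|], times
    [laplace mu (s / N^n) - 1], which tends to 0. *)
Lemma laplace_cantor_product (s : R) :
  (laplace mu s)%:C = cantor_product alpha s%:C.
Proof.
suff : (\prod_(0 <= k < n) cantor_factors alpha (s%:C : Cplx R) k : Cplx R)
    @[n --> \oo] --> ((laplace mu s)%:C : Cplx R).
  by move=> /cvg_limC <-.
apply/cvg_normcP => e e0.
pose c := 2 * (expR `|s| * `|s|).
have c0 : 0 <= c by rewrite !mulr_ge0// expR_ge0.
(* The first entry is the range of [laplace_near0]; the second makes [2 * expR |s| * d < e]. *)
pose d := Num.min (1 / 2) (e / (2 * expR `|s| + 1)).
have d0 : 0 < d by rewrite lt_min !divr_gt0// ltr_wpDl// mulr_ge0// expR_ge0.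
(* Since [n < N ^ n], this rank forces [|s| / N ^ n < d]. *)
exists (Num.bound (`|s| / d)) => // n /= mn.
have sd : `|s / N%:R ^+ n| < d.
  rewrite normrM normfV normrX normr_nat.
  rewrite ltr_pdivrMr ?exprn_gt0 ?ltr0n ?(leq_trans _ N2)//.
  rewrite -ltr_pdivrMl// mulrC.
  apply: lt_le_trans (archi_boundP _) _; first by rewrite divr_ge0// ltW.
  by rewrite -natrX ler_nat (leq_trans mn)// ltnW// ltn_expl.
rewrite [X in X - _](laplace_cantor_partial_product n) -[X in _ - X]mulr1.
rewrite -mulrBr normcM.
rewrite -(rmorph1 (real_complex R)) -rmorphB normc_real.
have h1 := normc_cantor_partial_product_le N2 alpha_simplex n s%:C.
rewrite normc_real in h1.
move: sd; rewrite lt_min => /andP[/ltW sd2].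
rewrite ltr_pdivlMr ?ltr_wpDl ?mulr_ge0 ?expR_ge0// => sde.
have h2 := laplace_near0 sd2.
apply: (@le_lt_trans _ _ (expR `|s| * (2 * `|s / N%:R ^+ n|))).
  by rewrite ler_pM// normc_ge0.
by have := normr_ge0 (s / N%:R ^+ n); lra.
Qed.

End CantorLaplace.

Theorem theorem3p4 (R : realType) (N : nat) (hN : (2 <= N)%N)
    (alpha : 'I_N -> R) (halpha : @simplex R N alpha) :
  (forall z : Cplx R, infprod_cvg (cantor_factors alpha z)) /\
  entire (cantor_product alpha) /\
  (forall mu : probability (measurableTypeR R) R,
     weighted_cantor_measure alpha mu ->
     forall s : R, (laplace mu s)%:C = cantor_product alpha (s%:C)).
Proof.
split; first exact: cantor_factors_cvg.
split; first exact: entire_cantor_product.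
by move=> mu mu_cantor s; exact: laplace_cantor_product.
Qed.
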